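(* A partial groupoid $X$ is embeddable if and only if its reduction $\mathcal{R}X$ is embeddable.
   Context: Let $\Upsilon$ be the category whose objects are the sets $[n]=\{0,1,\dots,n\}$, $n\ge 0$, with arbitrary functions as morphisms. A symmetric set is a functor $X\colon \Upsilon^{\mathrm{op}}\to \mathsf{Set}$, with $X_n=X([n])$; $\mathsf{Sym}$ is the category of symmetric sets and natural transformations. The Segal map sends $x\in X_n$ to the word of its principal edges (restrictions to $\{i-1,i\}$, $1\le i\le n$) in $X_1\times_{X_0}\cdots\times_{X_0}X_1$. $X$ is spiny if the Segal map is injective for all $n\ge1$. A partial groupoid is a spiny symmetric set; a partial group is a spiny symmetric set that is reduced, i.e. with $X_0$ a one-element set. The reduction $\mathcal{R}X$ of a symmetric set $X$ is obtained by identifying all vertices of $X$: for each $n$, $(\mathcal{R}X)_n$ is the quotient of $X_n$ identifying to a single element all simplices in the image of $X_0\to X_n$ (the map induced by $[n]\to[0]$). If $X$ is a partial groupoid, then $\mathcal{R}X$ is known to be a partial group. $N\colon\mathsf{Gpd}\to\mathsf{Sym}$ is the nerve functor, where $(NG)_n$ is the set of functors to $G$ from the groupoid with object set $[n]$ and exactly one morphism between any two objects; $\tau$ is its left adjoint (fundamental groupoid). A partial groupoid $X$ is embeddable if the unit map $X\to N\tau X$ is a monomorphism; equivalently, if there is a monomorphism $X\to NG$ for some groupoid $G$ (for a partial group, $G$ may be taken to be a group). *)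

(* Defs.v *)
From mathcomp Require Import all_boot.
From mathcomp Require Import boolp.

Set Implicit Arguments.
Unset Strict Implicit.
Unset Printing Implicit Defensive.

(* The object [n] = {0, ..., n} is 'I_n.+1, and the morphisms [m] -> [n] are
   all functions.  [act a x] is the contravariant action, written a^* x. *)
Record symSet := SymSet {
  simp :> nat -> Type;
  act : forall m n, ('I_m.+1 -> 'I_n.+1) -> simp n -> simp m;
  act_id : forall n (x : simp n), act id x = x;
  act_comp : forall l m n (a : 'I_l.+1 -> 'I_m.+1) (b : 'I_m.+1 -> 'I_n.+1)
    (x : simp n), act (b \o a) x = act a (act b x)
}.
Arguments act {s m n} a x.

Record symHom (X Y : symSet) := SymHom {
  hom_at :> forall n, X n -> Y n;
  hom_nat : forall m n (a : 'I_m.+1 -> 'I_n.+1) (x : X n),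
    hom_at (act a x) = act a (hom_at x)
}.
Arguments hom_at {X Y} s n x.

Lemma symHom_ext (X Y : symSet) (f g : symHom X Y) :
  (forall n (x : X n), f n x = g n x) -> f = g.
Proof.
case: f g => [f fN] [g gN] /= fg.
have E : f = g.
  by apply: functional_extensionality_dep => n; apply: funext => x; exact: fg.
by move: fN gN; rewrite E => fN gN; congr SymHom; exact: Prop_irrelevance.
Qed.

Lemma sym_comp_nat (X Y Z : symSet) (g : symHom Y Z) (f : symHom X Y) m n
    (a : 'I_m.+1 -> 'I_n.+1) (x : X n) :
  g m (f m (act a x)) = act a (g n (f n x)).
Proof. by rewrite !hom_nat. Qed.

Definition sym_comp (X Y Z : symSet) (g : symHom Y Z) (f : symHom X Y) :
  symHom X Z := SymHom (@sym_comp_nat X Y Z g f).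

Definition sym_mono (X Y : symSet) (f : symHom X Y) : Prop :=
  forall (Z : symSet) (g h : symHom Z X), sym_comp f g = sym_comp f h -> g = h.

Definition vertex_map n (i : 'I_n.+1) : 'I_1 -> 'I_n.+1 := fun=> i.
Definition edge_map n (i j : 'I_n.+1) : 'I_2 -> 'I_n.+1 :=
  fun k => if k == ord0 then i else j.

Definition vertex (X : symSet) n (i : 'I_n.+1) (x : X n) : X 0 :=
  act (vertex_map i) x.
Definition edge (X : symSet) n (i j : 'I_n.+1) (x : X n) : X 1 :=
  act (edge_map i j) x.
Definition source (X : symSet) (e : X 1) : X 0 := vertex ord0 e.
Definition target (X : symSet) (e : X 1) : X 0 := vertex ord_max e.
Definition degen (X : symSet) n (v : X 0) : X n := act (fun=> ord0) v.
Arguments degen {X} n v.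

Lemma vertex_edge_map n (i j : 'I_n.+1) (k : 'I_2) :
  edge_map i j \o vertex_map k = vertex_map (edge_map i j k).
Proof. by []. Qed.

Lemma source_edge (X : symSet) n (i j : 'I_n.+1) (x : X n) :
  source (edge i j x) = vertex i x.
Proof. by rewrite /source /vertex /edge -act_comp. Qed.

Lemma target_edge (X : symSet) n (i j : 'I_n.+1) (x : X n) :
  target (edge i j x) = vertex j x.
Proof. by rewrite /target /vertex /edge -act_comp. Qed.

(* The n-fold fibre product X_1 x_{X_0} ... x_{X_0} X_1. *)
Definition edge_word (X : symSet) n : Type :=
  {w : 'I_n -> X 1 |
    forall i j : 'I_n, j = i.+1 :> nat -> target (w i) = source (w j)}.

(* The edge {i, i+1}, for i = 0, ..., n-1; [lift ord0 i] has value i.+1. *)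
Definition principal_edge (X : symSet) n (x : X n) (i : 'I_n) : X 1 :=
  edge (widen_ord (leqnSn n) i) (lift ord0 i) x.

Lemma principal_edge_match (X : symSet) n (x : X n) (i j : 'I_n) :
  j = i.+1 :> nat ->
  target (principal_edge x i) = source (principal_edge x j).
Proof.
move=> ij; rewrite target_edge source_edge; congr vertex.
by apply: val_inj; rewrite /= ij.
Qed.

Definition segal (X : symSet) n (x : X n) : edge_word X n :=
  exist _ (principal_edge x) (@principal_edge_match X n x).

Definition spiny (X : symSet) : Prop :=
  forall n, 0 < n -> injective (@segal X n).

Definition partial_groupoid (X : symSet) : Prop := spiny X.

Definition quot (T : Type) (R : T -> T -> Prop) : Type :=
  {c : T -> Prop | exists x, c = R x}.

Definition cls (T : Type) (R : T -> T -> Prop) (x : T) : quot R :=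
  exist _ (R x) (ex_intro _ x erefl).

Definition repr (T : Type) (R : T -> T -> Prop) (q : quot R) : T :=
  sval (cid (svalP q)).

Lemma reprK (T : Type) (R : T -> T -> Prop) (q : quot R) : cls R (repr q) = q.
Proof.
rewrite /repr; case: cid => x /=; case: q => c cP /= E.
by apply: eq_exist; rewrite E.
Qed.

Record equivalence (T : Type) (R : T -> T -> Prop) : Prop := Equivalence {
  eqv_refl : forall x, R x x;
  eqv_sym : forall x y, R x y -> R y x;
  eqv_trans : forall y x z, R x y -> R y z -> R x z
}.

Lemma clsP (T : Type) (R : T -> T -> Prop) (eR : equivalence R) (x y : T) :
  cls R x = cls R y <-> R x y.
Proof.
split=> [E | xy].
  by have -> : R x = R y := congr1 sval E; exact: eqv_refl eR y.
apply: eq_exist; apply/predeqP => z; split.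
  exact: (eqv_trans eR (eqv_sym eR xy)).
exact: (eqv_trans eR xy).
Qed.

Lemma repr_cls (T : Type) (R : T -> T -> Prop) (eR : equivalence R) (x : T) :
  R (repr (cls R x)) x.
Proof. by apply/(clsP eR); rewrite reprK. Qed.

Definition totally_degenerate (X : symSet) n (x : X n) : Prop :=
  exists v : X 0, x = degen n v.

(* The generated equivalence relation: it identifies all the simplices in the
   image of X_0 -> X_n, and nothing else. *)
Definition red_rel (X : symSet) n (x y : X n) : Prop :=
  x = y \/ (totally_degenerate x /\ totally_degenerate y).

Lemma red_rel_equiv (X : symSet) n : equivalence (@red_rel X n).
Proof.
split=> [x|x y [->|[]]|y x z [->|[dx dy]] [<-|[dy' dz]]];
  by [left | right].
Qed.

Lemma totally_degenerate_act (X : symSet) m n (a : 'I_m.+1 -> 'I_n.+1) (x : X n) :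
  totally_degenerate x -> totally_degenerate (act a x).
Proof. by case=> v ->; exists v; rewrite /degen -act_comp. Qed.

Lemma red_rel_act (X : symSet) m n (a : 'I_m.+1 -> 'I_n.+1) (x y : X n) :
  red_rel x y -> red_rel (act a x) (act a y).
Proof.
by case=> [->|[dx dy]]; [left | right; split; exact: totally_degenerate_act].
Qed.

Definition red_act (X : symSet) m n (a : 'I_m.+1 -> 'I_n.+1)
    (q : quot (@red_rel X n)) : quot (@red_rel X m) :=
  cls _ (act a (repr q)).

Lemma red_act_cls (X : symSet) m n (a : 'I_m.+1 -> 'I_n.+1) (x : X n) :
  red_act a (cls (@red_rel X n) x) = cls (@red_rel X m) (act a x).
Proof.
apply/(clsP (@red_rel_equiv X m)); apply: red_rel_act.
exact: repr_cls (@red_rel_equiv X n) x.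
Qed.

Lemma red_act_id (X : symSet) n (q : quot (@red_rel X n)) : red_act id q = q.
Proof. by rewrite -[q]reprK red_act_cls act_id. Qed.

Lemma red_act_comp (X : symSet) l m n (a : 'I_l.+1 -> 'I_m.+1)
    (b : 'I_m.+1 -> 'I_n.+1) (q : quot (@red_rel X n)) :
  red_act (b \o a) q = red_act a (red_act b q).
Proof. by rewrite -[q]reprK !red_act_cls act_comp. Qed.

Definition reduction (X : symSet) : symSet :=
  SymSet (@red_act_id X) (@red_act_comp X).

(* [gcomp f g] is "f, then g". *)
Record groupoid := Groupoid {
  obj :> Type;
  ghom : obj -> obj -> Type;
  gid : forall x, ghom x x;
  gcomp : forall x y z, ghom x y -> ghom y z -> ghom x z;
  ginv : forall x y, ghom x y -> ghom y x;
  gcompA : forall x y z t (f : ghom x y) (g : ghom y z) (h : ghom z t),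
    gcomp f (gcomp g h) = gcomp (gcomp f g) h;
  gcomp1l : forall x y (f : ghom x y), gcomp (gid x) f = f;
  gcomp1r : forall x y (f : ghom x y), gcomp f (gid y) = f;
  gcompVl : forall x y (f : ghom x y), gcomp (ginv f) f = gid y;
  gcompVr : forall x y (f : ghom x y), gcomp f (ginv f) = gid x
}.
Arguments ghom {_} _ _.
Arguments gid {_} _.
Arguments gcomp {_ _ _ _} _ _.
Arguments ginv {_ _ _} _.

Record functor (G H : groupoid) := Functor {
  fobj :> G -> H;
  fmap : forall x y : G, ghom x y -> ghom (fobj x) (fobj y);
  fmap_id : forall x : G, fmap (gid x) = gid (fobj x);
  fmap_comp : forall (x y z : G) (f : ghom x y) (g : ghom y z),
    fmap (gcomp f g) = gcomp (fmap f) (fmap g)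
}.
Arguments fmap {_ _} _ {_ _} _.

Lemma fun_comp_id (G H K : groupoid) (F : functor H K) (E : functor G H)
    (x : G) : fmap F (fmap E (gid x)) = gid (F (E x)).
Proof. by rewrite !fmap_id. Qed.

Lemma fun_comp_comp (G H K : groupoid) (F : functor H K) (E : functor G H)
    (x y z : G) (f : ghom x y) (g : ghom y z) :
  fmap F (fmap E (gcomp f g)) = gcomp (fmap F (fmap E f)) (fmap F (fmap E g)).
Proof. by rewrite !fmap_comp. Qed.

Definition fun_comp (G H K : groupoid) (F : functor H K) (E : functor G H) :
  functor G K :=
  @Functor G K (F \o E) (fun x y f => fmap F (fmap E f))
    (@fun_comp_id G H K F E) (@fun_comp_comp G H K F E).

Definition hcast (G : groupoid) (x x' y y' : G) (ex : x = x') (ey : y = y')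
    (f : ghom x y) : ghom x' y' :=
  ecast z (ghom x' z) ey (ecast z (ghom z y) ex f).

Lemma functor_ext (G H : groupoid) (F E : functor G H)
    (e0 : forall x, F x = E x) :
  (forall x y (f : ghom x y), hcast (e0 x) (e0 y) (fmap F f) = fmap E f) ->
  F = E.
Proof.
case: F E e0 => [F0 F1 Fi Fc] [E0 E1 Ei Ec] /= e0.
have EF : F0 = E0 by exact: funext.
subst E0 => e1.
have EF1 : F1 = E1.
  apply: functional_extensionality_dep => x.
  apply: functional_extensionality_dep => y; apply: funext => f.
  by rewrite -e1 (Prop_irrelevance (e0 x) erefl) (Prop_irrelevance (e0 y) erefl).
subst E1; congr Functor; exact: Prop_irrelevance.
Qed.

Lemma functor_comp_assoc (G H K L : groupoid) (F : functor K L)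
    (E : functor H K) (D : functor G H) :
  fun_comp F (fun_comp E D) = fun_comp (fun_comp F E) D.
Proof.
exact: (@functor_ext _ _ (fun_comp F (fun_comp E D)) (fun_comp (fun_comp F E) D)
  (fun=> erefl)).
Qed.

Definition codisc (T : Type) : groupoid :=
  @Groupoid T (fun _ _ => unit) (fun=> tt) (fun _ _ _ _ _ => tt)
    (fun _ _ _ => tt) (fun _ _ _ _ _ _ _ => erefl)
    (fun _ _ 'tt => erefl) (fun _ _ 'tt => erefl)
    (fun _ _ _ => erefl) (fun _ _ _ => erefl).

Definition codisc_map (S T : Type) (a : S -> T) :
  functor (codisc S) (codisc T) :=
  @Functor (codisc S) (codisc T) a (fun _ _ _ => tt)
    (fun=> erefl) (fun _ _ _ _ _ => erefl).

Definition nerve_simp (G : groupoid) (n : nat) : Type :=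
  functor (codisc 'I_n.+1) G.

Definition nerve_act (G : groupoid) m n (a : 'I_m.+1 -> 'I_n.+1)
    (F : nerve_simp G n) : nerve_simp G m := fun_comp F (codisc_map a).

Lemma nerve_act_id (G : groupoid) n (F : nerve_simp G n) : nerve_act id F = F.
Proof. by apply: (@functor_ext _ _ (nerve_act id F) F (fun=> erefl)) => x y []. Qed.

Lemma nerve_act_comp (G : groupoid) l m n (a : 'I_l.+1 -> 'I_m.+1)
    (b : 'I_m.+1 -> 'I_n.+1) (F : nerve_simp G n) :
  nerve_act (b \o a) F = nerve_act a (nerve_act b F).
Proof.
exact: (@functor_ext _ _ (nerve_act (b \o a) F) (nerve_act a (nerve_act b F))
  (fun=> erefl)).
Qed.

Definition nerve (G : groupoid) : symSet :=
  SymSet (@nerve_act_id G) (@nerve_act_comp G).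

Lemma nerve_map_nat (G H : groupoid) (F : functor G H) m n
    (a : 'I_m.+1 -> 'I_n.+1) (x : nerve G n) :
  fun_comp F (act a x) = act a (fun_comp F x : nerve H n).
Proof. exact: functor_comp_assoc. Qed.

Definition nerve_map (G H : groupoid) (F : functor G H) :
  symHom (nerve G) (nerve H) :=
  @SymHom (nerve G) (nerve H) (fun n (x : nerve G n) => fun_comp F x)
    (@nerve_map_nat G H F).

(* Formal composites of edges and their inverses.  The endpoints of an edge are
   recorded up to a proof of equality, so that edges with propositionally equal
   endpoints can be compared. *)
Inductive word (X : symSet) : X 0 -> X 0 -> Type :=
| wid (x : X 0) : word x x
| wedge (x y : X 0) (e : X 1) (hs : source e = x) (ht : target e = y) : word x y
| wcomp (x y z : X 0) (u : word x y) (v : word y z) : word x z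
| winv (x y : X 0) (u : word x y) : word y x.
Arguments wid {X} x.
Arguments wedge {X x y} e hs ht.
Arguments wcomp {X x y z} u v.
Arguments winv {X x y} u.

Definition o0 : 'I_3 := @Ordinal 3 0 isT.
Definition o1 : 'I_3 := @Ordinal 3 1 isT.
Definition o2 : 'I_3 := @Ordinal 3 2 isT.

(* The congruence generated by the groupoid laws, the 2-simplices and the
   degenerate edges. *)
Inductive weq (X : symSet) : forall x y : X 0, word x y -> word x y -> Prop :=
| weq_refl x y (u : word x y) : weq u u
| weq_sym x y (u v : word x y) : weq u v -> weq v u
| weq_trans x y (u v w : word x y) : weq u v -> weq v w -> weq u w
| weq_wcomp x y z (u u' : word x y) (v v' : word y z) :
    weq u u' -> weq v v' -> weq (wcomp u v) (wcomp u' v')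
| weq_winv x y (u u' : word x y) : weq u u' -> weq (winv u) (winv u')
| weq_assoc x y z t (u : word x y) (v : word y z) (w : word z t) :
    weq (wcomp u (wcomp v w)) (wcomp (wcomp u v) w)
| weq_1l x y (u : word x y) : weq (wcomp (wid x) u) u
| weq_1r x y (u : word x y) : weq (wcomp u (wid y)) u
| weq_Vl x y (u : word x y) : weq (wcomp (winv u) u) (wid y)
| weq_Vr x y (u : word x y) : weq (wcomp u (winv u)) (wid x)
| weq_simplex (s : X 2) (x y z : X 0)
    (s01 : source (edge o0 o1 s) = x) (t01 : target (edge o0 o1 s) = y)
    (s12 : source (edge o1 o2 s) = y) (t12 : target (edge o1 o2 s) = z)
    (s02 : source (edge o0 o2 s) = x) (t02 : target (edge o0 o2 s) = z) :
    weq (wcomp (wedge (edge o0 o1 s) s01 t01) (wedge (edge o1 o2 s) s12 t12))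
        (wedge (edge o0 o2 s) s02 t02)
| weq_degen (x : X 0)
    (hs : source (degen 1 x) = x) (ht : target (degen 1 x) = x) :
    weq (wedge (degen 1 x) hs ht) (wid x).

Lemma weq_equiv (X : symSet) (x y : X 0) : equivalence (@weq X x y).
Proof.
split; [exact: weq_refl | exact: weq_sym |].
by move=> v u w; exact: weq_trans.
Qed.

Definition tau_hom (X : symSet) (x y : X 0) : Type := quot (@weq X x y).

Definition tau_cls (X : symSet) (x y : X 0) (u : word x y) : tau_hom x y :=
  cls (@weq X x y) u.

Lemma tau_clsP (X : symSet) (x y : X 0) (u v : word x y) :
  tau_cls u = tau_cls v <-> weq u v.
Proof. exact: clsP (@weq_equiv X x y) u v. Qed.

Lemma tau_repr (X : symSet) (x y : X 0) (u : word x y) :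
  weq (repr (tau_cls u)) u.
Proof. exact: repr_cls (@weq_equiv X x y) u. Qed.

Lemma tau_hom_ind (X : symSet) (x y : X 0) (P : tau_hom x y -> Prop) :
  (forall u, P (tau_cls u)) -> forall p, P p.
Proof. by move=> H p; rewrite -[p]reprK; exact: H. Qed.

Definition tau_comp (X : symSet) (x y z : X 0) (p : tau_hom x y)
  (q : tau_hom y z) : tau_hom x z := tau_cls (wcomp (repr p) (repr q)).

Definition tau_inv (X : symSet) (x y : X 0) (p : tau_hom x y) : tau_hom y x :=
  tau_cls (winv (repr p)).

Lemma tau_compE (X : symSet) (x y z : X 0) (u : word x y) (v : word y z) :
  tau_comp (tau_cls u) (tau_cls v) = tau_cls (wcomp u v).
Proof. by apply/tau_clsP; apply: weq_wcomp; exact: tau_repr. Qed.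

Lemma tau_invE (X : symSet) (x y : X 0) (u : word x y) :
  tau_inv (tau_cls u) = tau_cls (winv u).
Proof. by apply/tau_clsP; apply: weq_winv; exact: tau_repr. Qed.

Lemma tau_compA (X : symSet) (x y z t : X 0) (p : tau_hom x y)
    (q : tau_hom y z) (r : tau_hom z t) :
  tau_comp p (tau_comp q r) = tau_comp (tau_comp p q) r.
Proof.
elim/tau_hom_ind: p => u; elim/tau_hom_ind: q => v; elim/tau_hom_ind: r => w.
by rewrite !tau_compE; apply/tau_clsP; exact: weq_assoc.
Qed.

Lemma tau_comp1l (X : symSet) (x y : X 0) (p : tau_hom x y) :
  tau_comp (tau_cls (wid x)) p = p.
Proof.
elim/tau_hom_ind: p => u; rewrite tau_compE.
by apply/tau_clsP; exact: weq_1l.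
Qed.

Lemma tau_comp1r (X : symSet) (x y : X 0) (p : tau_hom x y) :
  tau_comp p (tau_cls (wid y)) = p.
Proof.
elim/tau_hom_ind: p => u; rewrite tau_compE.
by apply/tau_clsP; exact: weq_1r.
Qed.

Lemma tau_compVl (X : symSet) (x y : X 0) (p : tau_hom x y) :
  tau_comp (tau_inv p) p = tau_cls (wid y).
Proof.
elim/tau_hom_ind: p => u; rewrite tau_invE tau_compE.
by apply/tau_clsP; exact: weq_Vl.
Qed.

Lemma tau_compVr (X : symSet) (x y : X 0) (p : tau_hom x y) :
  tau_comp p (tau_inv p) = tau_cls (wid x).
Proof.
elim/tau_hom_ind: p => u; rewrite tau_invE tau_compE.
by apply/tau_clsP; exact: weq_Vr.
Qed.

Definition tau (X : symSet) : groupoid :=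
  Groupoid (@tau_compA X) (@tau_comp1l X) (@tau_comp1r X)
    (@tau_compVl X) (@tau_compVr X).

Definition unit_fmap (X : symSet) n (x : X n) (i j : 'I_n.+1) :
    @ghom (tau X) (vertex i x) (vertex j x) :=
  tau_cls (wedge (edge i j x) (source_edge i j x) (target_edge i j x)).

Lemma wedge_congr (X : symSet) (x y : X 0) (e e' : X 1) (hs : source e = x)
    (ht : target e = y) (hs' : source e' = x) (ht' : target e' = y) :
  e = e' -> wedge e hs ht = wedge e' hs' ht'.
Proof.
move=> E; move: hs' ht'; rewrite -E => hs' ht'.
by congr wedge; exact: Prop_irrelevance.
Qed.

Lemma unit_fmap_id (X : symSet) n (x : X n) (i : 'I_n.+1) :
  unit_fmap x i i = gid (vertex i x : tau X).
Proof.
have E : degen 1 (vertex i x) = edge i i x.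
  rewrite /degen /vertex /edge -act_comp; congr act.
  by apply: funext => k; rewrite /edge_map /= if_same.
apply/tau_clsP; have := @weq_degen X (vertex i x); rewrite E; exact.
Qed.

Definition tri_map n (i j k : 'I_n.+1) : 'I_3 -> 'I_n.+1 :=
  fun l => if l == o0 then i else if l == o1 then j else k.

Lemma unit_fmap_comp (X : symSet) n (x : X n) (i j k : 'I_n.+1) :
  unit_fmap x i k = gcomp (unit_fmap x i j) (unit_fmap x j k).
Proof.
have E (a b : 'I_3) : edge a b (act (tri_map i j k) x) =
    edge (tri_map i j k a) (tri_map i j k b) x.
  rewrite /edge -act_comp; congr act.
  by apply: funext => l; rewrite /edge_map /=; case: ifP.
rewrite [RHS]/= tau_compE; apply/esym/tau_clsP.
by have := @weq_simplex X (act (tri_map i j k) x); rewrite !E; exact.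
Qed.

Definition unit_at (X : symSet) n (x : X n) : nerve (tau X) n :=
  @Functor (codisc 'I_n.+1) (tau X) (fun i => vertex i x)
    (fun i j _ => unit_fmap x i j) (@unit_fmap_id X n x)
    (fun i j k _ _ => unit_fmap_comp x i j k).

Lemma vertex_act (X : symSet) m n (a : 'I_m.+1 -> 'I_n.+1) (x : X n) i :
  vertex i (act a x) = vertex (a i) x.
Proof. by rewrite /vertex -act_comp. Qed.

Lemma edge_act (X : symSet) m n (a : 'I_m.+1 -> 'I_n.+1) (x : X n) i j :
  edge i j (act a x) = edge (a i) (a j) x.
Proof.
rewrite /edge -act_comp; congr act.
by apply: funext => k; rewrite /edge_map /=; case: ifP.
Qed.

Lemma hcast_wedge (X : symSet) (x y x' y' : X 0) (ex : x = x') (ey : y = y')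
    (e : X 1) (hs : source e = x) (ht : target e = y) :
  @hcast (tau X) x x' y y' ex ey (tau_cls (wedge e hs ht)) =
  tau_cls (wedge e (etrans hs ex) (etrans ht ey)).
Proof. by case: x' / ex; case: y' / ey. Qed.

Lemma unit_nat (X : symSet) m n (a : 'I_m.+1 -> 'I_n.+1) (x : X n) :
  unit_at (act a x) = act a (unit_at x).
Proof.
apply: (@functor_ext _ _ (unit_at (act a x)) (act a (unit_at x))
  (vertex_act a x)) => i j _ /=.
rewrite /unit_fmap hcast_wedge; congr tau_cls; apply: wedge_congr.
exact: edge_act.
Qed.

Definition tau_unit (X : symSet) : symHom X (nerve (tau X)) :=
  SymHom (@unit_nat X).

Lemma hcast_id (G : groupoid) (x x' : G) (e e' : x = x') :
  hcast e e' (gid x) = gid x'.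
Proof. by rewrite (Prop_irrelevance e' e); case: x' / e {e'}. Qed.

Lemma hcast_gcomp (G : groupoid) (x x' y y' z z' : G) (ex : x = x')
    (ey ey' : y = y') (ez : z = z') (f : ghom x y) (g : ghom y z) :
  gcomp (hcast ex ey f) (hcast ey' ez g) = hcast ex ez (gcomp f g).
Proof.
rewrite (Prop_irrelevance ey' ey).
by case: x' / ex; case: y' / ey {ey'}; case: z' / ez.
Qed.

Lemma hcastK (G : groupoid) (x x' y y' x'' y'' : G) (ex : x = x') (ey : y = y')
    (ex' : x' = x'') (ey' : y' = y'') (f : ghom x y) :
  hcast ex' ey' (hcast ex ey f) = hcast (etrans ex ex') (etrans ey ey') f.
Proof. by case: x'' / ex'; case: y'' / ey'. Qed.

Lemma hcast_irr (G : groupoid) (x x' y y' : G) (ex ex' : x = x')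
    (ey ey' : y = y') (f : ghom x y) : hcast ex ey f = hcast ex' ey' f.
Proof. by rewrite (Prop_irrelevance ex ex') (Prop_irrelevance ey ey'). Qed.

Lemma hcast_ginv (G : groupoid) (x x' y y' : G) (ex : x = x') (ey : y = y')
    (f : ghom x y) : hcast ey ex (ginv f) = ginv (hcast ex ey f).
Proof. by case: x' / ex; case: y' / ey. Qed.

Lemma fmap_eq (G H : groupoid) (F E : functor G H) (x y : G) (f : ghom x y)
    (ex : F x = E x) (ey : F y = E y) :
  F = E -> hcast ex ey (fmap F f) = fmap E f.
Proof.
move=> FE; move: ex ey; rewrite FE => ex ey.
by rewrite (Prop_irrelevance ex erefl) (Prop_irrelevance ey erefl).
Qed.

Lemma ginv_unique (G : groupoid) (x y : G) (f : ghom x y) (g : ghom y x) :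
  gcomp g f = gid y -> g = ginv f.
Proof.
by move=> gf; rewrite -[g]gcomp1r -(gcompVr f) gcompA gf gcomp1l.
Qed.

Lemma fmap_ginv (G H : groupoid) (F : functor G H) (x y : G) (f : ghom x y) :
  fmap F (ginv f) = ginv (fmap F f).
Proof. by apply: ginv_unique; rewrite -fmap_comp gcompVl fmap_id. Qed.

Definition tr_obj (X : symSet) (G : groupoid) (f : symHom X (nerve G))
  (v : X 0) : G := (f 0 v : functor _ G) ord0.

Lemma tr_obj_vertex (X : symSet) (G : groupoid) (f : symHom X (nerve G)) n
    (x : X n) (i : 'I_n.+1) :
  (f n x : functor _ G) i = tr_obj f (vertex i x).
Proof. by rewrite /tr_obj /vertex hom_nat. Qed.

Fixpoint tr_word (X : symSet) (G : groupoid) (f : symHom X (nerve G))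
    (x y : X 0) (u : word x y) : ghom (tr_obj f x) (tr_obj f y) :=
  match u with
  | wid x => gid (tr_obj f x)
  | wedge x y e hs ht =>
      hcast (etrans (tr_obj_vertex f e ord0) (congr1 (tr_obj f) hs))
            (etrans (tr_obj_vertex f e ord_max) (congr1 (tr_obj f) ht))
            (@fmap _ _ (f 1 e : functor _ G) ord0 ord_max tt)
  | wcomp _ _ _ u v => gcomp (tr_word f u) (tr_word f v)
  | winv _ _ u => ginv (tr_word f u)
  end.

Lemma tr_word_edge (X : symSet) (G : groupoid) (f : symHom X (nerve G)) n
    (s : X n) (i j : 'I_n.+1) (x y : X 0) (hs : source (edge i j s) = x)
    (ht : target (edge i j s) = y)
    (ex : (f n s : functor _ G) i = tr_obj f x)
    (ey : (f n s : functor _ G) j = tr_obj f y) :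
  tr_word f (wedge (edge i j s) hs ht) =
  hcast ex ey (@fmap _ _ (f n s : functor _ G) i j tt).
Proof.
have E : (f 1 (edge i j s) : functor _ G) = act (edge_map i j) (f n s).
  by rewrite /edge hom_nat.
have e0 : (f 1 (edge i j s) : functor _ G) ord0 = (f n s : functor _ G) i.
  by rewrite E.
have e1 : (f 1 (edge i j s) : functor _ G) ord_max = (f n s : functor _ G) j.
  by rewrite E.
have := @fmap_eq (codisc 'I_2) G (f 1 (edge i j s))
  (act (edge_map i j) (f n s)) ord0 ord_max tt e0 e1 E.
rewrite /= => <-; rewrite hcastK; exact: hcast_irr.
Qed.

Lemma tr_word_weq (X : symSet) (G : groupoid) (f : symHom X (nerve G))
    (x y : X 0) (u v : word x y) : weq u v -> tr_word f u = tr_word f v.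
Proof.
elim=> //=; first by move=> ? ? u' v' w' _ -> _ ->.
- by move=> ? ? ? ? ? ? ? _ -> _ ->.
- by move=> ? ? ? ? _ ->.
- by move=> *; rewrite gcompA.
- by move=> *; rewrite gcomp1l.
- by move=> *; rewrite gcomp1r.
- by move=> *; rewrite gcompVl.
- by move=> *; rewrite gcompVr.
- move=> s x' y' z' s01 t01 s12 t12 s02 t02.
  have ex : (f 2 s : functor _ G) o0 = tr_obj f x'.
    by rewrite tr_obj_vertex -s01 source_edge.
  have ey : (f 2 s : functor _ G) o1 = tr_obj f y'.
    by rewrite tr_obj_vertex -t01 target_edge.
  have ez : (f 2 s : functor _ G) o2 = tr_obj f z'.
    by rewrite tr_obj_vertex -t02 target_edge.
  have := @tr_word_edge X G f 2 s o0 o1 x' y' s01 t01 ex ey => /= ->.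
  have := @tr_word_edge X G f 2 s o1 o2 y' z' s12 t12 ey ez => /= ->.
  have := @tr_word_edge X G f 2 s o0 o2 x' z' s02 t02 ex ez => /= ->.
  by rewrite hcast_gcomp -fmap_comp.
- move=> x' hs ht.
  have E : degen 1 x' = edge ord0 ord0 x'.
    rewrite /degen /edge; congr act.
    by apply: funext => k; rewrite /edge_map if_same.
  move: hs ht; rewrite E => hs ht.
  have e : (f 0 x' : functor _ G) ord0 = tr_obj f x' by [].
  have := @tr_word_edge X G f 0 x' ord0 ord0 x' x' hs ht e e => /= ->.
  by rewrite (fmap_id (f 0 x') ord0) hcast_id.
Qed.

Definition tr_hom (X : symSet) (G : groupoid) (f : symHom X (nerve G))
    (x y : X 0) (p : tau_hom x y) : ghom (tr_obj f x) (tr_obj f y) :=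
  tr_word f (repr p).

Lemma tr_homE (X : symSet) (G : groupoid) (f : symHom X (nerve G)) (x y : X 0)
    (u : word x y) : tr_hom f (tau_cls u) = tr_word f u.
Proof. exact: tr_word_weq (tau_repr u). Qed.

Lemma tr_hom_id (X : symSet) (G : groupoid) (f : symHom X (nerve G))
    (x : tau X) : tr_hom f (gid x) = gid (tr_obj f x).
Proof. exact: tr_homE. Qed.

Lemma tr_hom_comp (X : symSet) (G : groupoid) (f : symHom X (nerve G))
    (x y z : tau X) (p : ghom x y) (q : ghom y z) :
  tr_hom f (gcomp p q) = gcomp (tr_hom f p) (tr_hom f q).
Proof.
elim/tau_hom_ind: p => u; elim/tau_hom_ind: q => v.
by rewrite /= tau_compE !tr_homE.
Qed.

Definition transpose (X : symSet) (G : groupoid) (f : symHom X (nerve G)) :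
  functor (tau X) G :=
  @Functor (tau X) G (tr_obj f) (@tr_hom X G f) (@tr_hom_id X G f)
    (@tr_hom_comp X G f).

Lemma transposeK (X : symSet) (G : groupoid) (f : symHom X (nerve G)) :
  sym_comp (nerve_map (transpose f)) (tau_unit X) = f.
Proof.
apply: symHom_ext => n x.
pose F : functor (codisc 'I_n.+1) G := fun_comp (transpose f) (unit_at x).
have e0 i : F i = (f n x : functor _ G) i by rewrite tr_obj_vertex.
apply: (@functor_ext _ _ F (f n x) e0) => i j t; rewrite [fmap F t]/=.
rewrite /unit_fmap tr_homE; case: t.
rewrite (@tr_word_edge X G f n x i j _ _ _ _ (esym (e0 i)) (esym (e0 j))).
rewrite hcastK (@hcast_irr _ _ _ _ _ _ erefl _ erefl) //.
Qed.

Lemma vertex0 (X : symSet) (v : X 0) : vertex ord0 v = v.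
Proof.
rewrite /vertex -[RHS]act_id; congr act.
by apply: funext => k; rewrite [k]ord1.
Qed.

Lemma edge01 (X : symSet) (e : X 1) : edge ord0 ord_max e = e.
Proof.
rewrite /edge -[RHS]act_id; congr act.
apply: funext => k; rewrite /edge_map; case: eqP => [->//|k0].
case: k k0 => [[|[|m]] km] // k0; last exact: val_inj.
by case: k0; exact: val_inj.
Qed.

Lemma transpose_unique (X : symSet) (G : groupoid) (F E : functor (tau X) G) :
  sym_comp (nerve_map F) (tau_unit X) = sym_comp (nerve_map E) (tau_unit X) ->
  F = E.
Proof.
move=> FE.
have FEn n (x : X n) : fun_comp F (unit_at x) = fun_comp E (unit_at x).
  by have := congr1 (fun h : symHom X (nerve G) => h n x) FE.
have e0 v : F v = E v.
  have := congr1 (fun h : functor (codisc 'I_1) G => h ord0) (FEn 0 v).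
  by rewrite /= vertex0.
apply: (@functor_ext _ _ F E e0) => x y p; elim/tau_hom_ind: p => u.
elim: u => {x y} [x|x y e hs ht|x y z u IHu v IHv|x y u IHu].
- by rewrite (fmap_id F x) (fmap_id E x) hcast_id.
- case: x / hs; case: y / ht.
  have := @fmap_eq (codisc 'I_2) G (fun_comp F (unit_at e))
    (fun_comp E (unit_at e)) ord0 ord_max tt (e0 (source e)) (e0 (target e))
    (FEn 1 e).
  rewrite /= /unit_fmap (@wedge_congr X _ _ _ e _ _ erefl erefl) //.
  exact: edge01.
- rewrite -tau_compE (fmap_comp F (tau_cls u) (tau_cls v)).
  rewrite (fmap_comp E (tau_cls u) (tau_cls v)).
  by rewrite -(hcast_gcomp _ (e0 y) (e0 y)) IHu IHv.
- rewrite -tau_invE (fmap_ginv F (tau_cls u)) (fmap_ginv E (tau_cls u)).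
  by rewrite hcast_ginv IHu.
Qed.

(* Hence [tau] is left adjoint to the nerve, with unit [tau_unit]. *)
Lemma tau_universal (X : symSet) (G : groupoid) (f : symHom X (nerve G)) :
  exists! F : functor (tau X) G, sym_comp (nerve_map F) (tau_unit X) = f.
Proof.
exists (transpose f); split=> [|F Ff]; first exact: transposeK.
by apply: transpose_unique; rewrite transposeK.
Qed.

Definition embeddable (X : symSet) : Prop := sym_mono (tau_unit X).

(* Main.v *)
From mathcomp Require Import all_boot all_algebra boolp functions.
Require Import Defs.
Import GRing.Theory.

Set Implicit Arguments.
Unset Strict Implicit.
Unset Printing Implicit Defensive.

(** An injection of symmetric sets X -> N G exists for some groupoid G exactly
    when the unit of X is injective, so embeddings may be built into the nerve
    of whichever groupoid is convenient.

    From the reduction to X: the composite X -> RX -> N tau RX factors through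
    the unit of X, so two simplices with the same image in N tau X become equal
    in RX.  Hence they are equal, or both totally degenerate; in the latter
    case each is the degeneracy of its initial vertex, and the unit of X is
    injective on vertices.

    From X to the reduction: it suffices to find, for every groupoid G, a group
    U and a functor G -> U which is injective except that it kills all the
    identities.  For then two simplices of N G with the same image in N U are
    equal or both totally degenerate ([spread_nerve_inj]), so that the map
    RX -> N U induced by X -> N tau X -> N U is injective.  The universal group
    of G has this property, by a normal form theorem for words of arrows; the
    following wreath product has it for more direct reasons.  First, G has a
    functor to the group K of families of loops, faithful on each hom-set:
    transport an arrow to a loop at each object along chosen arrows.  Next, let
    Q be the additive group of integer-valued functions on the objects, d_x in Q
    the indicator function of x, and U the unrestricted regular wreath product
    of K by Q.  Send g : x -> y to the element of U whose K-part is the image of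
    g placed at coordinate d_x, and whose Q-part is d_y - d_x; this is the
    functor G -> K, with K placed at coordinate 0, twisted by the elements d_x.
    The Q-part recovers x and y when x <> y, and the position of the K-part
    recovers x when g is a loop other than an identity. *)

(** * Monomorphisms and embeddability *)

Definition levelwise_inj (X Y : symSet) (f : symHom X Y) : Prop :=
  forall n, injective (f n).

Definition representable (k : nat) : symSet :=
  @SymSet (fun n => 'I_n.+1 -> 'I_k.+1) (fun _ _ a b => b \o a)
    (fun _ _ => erefl) (fun _ _ _ _ _ _ => erefl).

Definition yoneda (X : symSet) k (x : X k) : symHom (representable k) X :=
  @SymHom (representable k) X (fun n b => act b x)
    (fun m n a b => act_comp a b x).

(** Maps out of the representables detect simplices, by the Yoneda lemma. *)
Lemma sym_monoP (X Y : symSet) (f : symHom X Y) :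
  sym_mono f <-> levelwise_inj f.
Proof.
split=> [fmono n x y fxy | finj Z g h fgh].
  have E : yoneda x = yoneda y.
    by apply: fmono; apply: symHom_ext => m a /=; rewrite !hom_nat fxy.
  have := congr1 (fun h : symHom (representable n) X => h n id) E.
  by rewrite /= !act_id.
apply: symHom_ext => n z; apply: finj.
exact: (congr1 (fun h : symHom Z Y => h n z) fgh).
Qed.

(** Every map to a nerve factors through the unit. *)
Lemma tau_unit_finest (X : symSet) (G : groupoid) (f : symHom X (nerve G)) n
    (x y : X n) : tau_unit X n x = tau_unit X n y -> f n x = f n y.
Proof.
move=> xy; rewrite -(transposeK f).
exact: (congr1 (nerve_map (transpose f) n) xy).
Qed.

Lemma embeddable_of_inj (X : symSet) (G : groupoid) (f : symHom X (nerve G)) :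
  levelwise_inj f -> embeddable X.
Proof.
by move=> finj; apply/sym_monoP => n x y /(tau_unit_finest f); exact: finj.
Qed.

(** * Totally degenerate simplices and the reduction *)

Lemma vertex_degen (X : symSet) n (i : 'I_n.+1) (v : X 0) :
  vertex i (degen n v) = v.
Proof.
rewrite /vertex /degen -act_comp -[RHS]act_id; congr act.
by apply: funext => k; rewrite [k]ord1.
Qed.

Lemma totally_degenerateE (X : symSet) n (x : X n) :
  totally_degenerate x -> x = degen n (vertex ord0 x).
Proof. by case=> v ->; rewrite vertex_degen. Qed.

(** A totally degenerate simplex is the degeneracy of its initial vertex, and
    an injection reflects this equation, which is natural. *)
Lemma red_rel_inj (X Y : symSet) (f : symHom X Y) n (x y : X n) :
  levelwise_inj f -> red_rel (f n x) (f n y) -> red_rel x y.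
Proof.
move=> finj; case=> [/finj -> | [dx dy]]; first by left.
have down z : totally_degenerate (f n z) -> totally_degenerate z.
  move=> /totally_degenerateE fz; exists (vertex ord0 z); apply: finj.
  by rewrite fz /vertex /degen -!hom_nat.
by right; split; exact: down.
Qed.

Definition red_proj (X : symSet) : symHom X (reduction X) :=
  @SymHom X (reduction X) (fun n x => cls (@red_rel X n) x)
    (fun m n a x => esym (red_act_cls a x)).

Section RedLift.
Variables (X Y : symSet) (f : symHom X Y).
Hypothesis Y_reduced : forall v w : Y 0, v = w.

Lemma red_rel_hom n (x y : X n) : red_rel x y -> f n x = f n y.
Proof.
case=> [->//|[[v ->] [w ->]]].
by rewrite /degen !hom_nat; congr act; exact: Y_reduced.
Qed.

Definition red_lift_at n (q : reduction X n) : Y n := f n (repr q).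

Lemma red_lift_cls n (x : X n) : red_lift_at (cls (@red_rel X n) x) = f n x.
Proof. by apply: red_rel_hom; exact: repr_cls (@red_rel_equiv X n) x. Qed.

Lemma red_lift_nat m n (a : 'I_m.+1 -> 'I_n.+1) (q : reduction X n) :
  red_lift_at (act a q) = act a (red_lift_at q).
Proof. by rewrite -[q]reprK /= red_act_cls !red_lift_cls hom_nat. Qed.

Definition red_lift : symHom (reduction X) Y := SymHom red_lift_nat.

Lemma red_lift_inj :
  (forall n (x y : X n), f n x = f n y -> red_rel x y) ->
  levelwise_inj red_lift.
Proof.
move=> fR n p q; rewrite -[p]reprK -[q]reprK /= !red_lift_cls => fpq.
by apply/(clsP (@red_rel_equiv X n)); exact: fR.
Qed.

End RedLift.

(** * Transporting the arrows of a groupoid to loops *)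

(** Loops at all the objects at once: this avoids choosing a base point in each
    connected component. *)
Definition loops (G : groupoid) : Type := forall v : G, ghom v v.

Section BasedLoop.
Variable G : groupoid.
Implicit Types (v x y z : G).

Definition chosen v x : option (ghom v x) :=
  if pselect (inhabited (ghom v x)) is left h then Some (inhabited_witness h)
  else None.

Lemma chosen_ex v x (g : ghom v x) : exists p, chosen v x = Some p.
Proof.
rewrite /chosen; case: pselect => [h|[]]; last exact: inhabits g.
by exists (inhabited_witness h).
Qed.

Lemma chosen_None v x y (g : ghom x y) :
  chosen v x = None -> chosen v y = None.
Proof.
move=> vx; case vy: (chosen v y) => [q|] //.
by have [p] := chosen_ex (gcomp q (ginv g)); rewrite vx.
Qed.

Definition based_loop x y (g : ghom x y) : loops G := fun v =>
  match chosen v x, chosen v y with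
  | Some p, Some q => gcomp p (gcomp g (ginv q))
  | _, _ => gid v
  end.

Lemma based_loop_id x v : based_loop (gid x) v = gid v.
Proof.
by rewrite /based_loop; case: chosen => // p; rewrite gcomp1l gcompVr.
Qed.

Lemma based_loop_comp x y z (g : ghom x y) (h : ghom y z) v :
  based_loop (gcomp g h) v = gcomp (based_loop g v) (based_loop h v).
Proof.
rewrite /based_loop; case vx: (chosen v x) => [p|]; last first.
  by rewrite (chosen_None g vx) gcomp1l.
have [q ->] := chosen_ex (gcomp p g).
have [r ->] := chosen_ex (gcomp (gcomp p g) h).
rewrite -!gcompA; congr gcomp; congr gcomp.
by rewrite [gcomp (ginv q) _]gcompA gcompVl gcomp1l.
Qed.

Lemma gcomp_injl x y z (p : ghom x y) : injective (@gcomp G x y z p).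
Proof.
by move=> g h E; rewrite -[g]gcomp1l -[h]gcomp1l -(gcompVl p) -!gcompA E.
Qed.

Lemma gcomp_injr x y z (q : ghom y z) :
  injective (fun g : ghom x y => gcomp g q).
Proof.
by move=> g h E; rewrite -[g]gcomp1r -[h]gcomp1r -(gcompVr q) !gcompA E.
Qed.

(** The loop at the source of the two arrows suffices: there both chosen arrows
    exist, and they cancel. *)
Lemma based_loop_inj x y (g h : ghom x y) :
  (forall v, based_loop g v = based_loop h v) -> g = h.
Proof.
move=> /(_ x); rewrite /based_loop.
have [p ->] := chosen_ex (gid x); have [q ->] := chosen_ex g.
by move=> /gcomp_injl /gcomp_injr.
Qed.

End BasedLoop.

(** * A group separating the arrows of a groupoid *)

Section Wreath.
Local Open Scope ring_scope.
Variables (G : groupoid) (Q : zmodType).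
Implicit Types a b c : (Q -> loops G) * Q.

Definition wreath_mul a b : (Q -> loops G) * Q :=
  (fun u v => gcomp (a.1 u v) (b.1 (u + a.2) v), a.2 + b.2).

Definition wreath_one : (Q -> loops G) * Q := (fun=> @gid G, 0).

Definition wreath_inv a : (Q -> loops G) * Q :=
  (fun u v => ginv (a.1 (u - a.2) v), - a.2).

Lemma wreath_ext a b :
  (forall u v, a.1 u v = b.1 u v) -> a.2 = b.2 -> a = b.
Proof.
case: a b => [a p] [b q] /= ab ->; congr pair; apply: funext => u.
by apply: functional_extensionality_dep => v; exact: ab.
Qed.

Lemma wreath_mulA a b c :
  wreath_mul a (wreath_mul b c) = wreath_mul (wreath_mul a b) c.
Proof. by apply: wreath_ext => [u v|] /=; rewrite ?gcompA addrA. Qed.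

Lemma wreath_mul1l a : wreath_mul wreath_one a = a.
Proof. by apply: wreath_ext => [u v|] /=; rewrite ?gcomp1l ?addr0 ?add0r. Qed.

Lemma wreath_mul1r a : wreath_mul a wreath_one = a.
Proof. by apply: wreath_ext => [u v|] /=; rewrite ?gcomp1r ?addr0. Qed.

Lemma wreath_mulVl a : wreath_mul (wreath_inv a) a = wreath_one.
Proof. by apply: wreath_ext => [u v|] /=; rewrite ?gcompVl ?addNr. Qed.

Lemma wreath_mulVr a : wreath_mul a (wreath_inv a) = wreath_one.
Proof. by apply: wreath_ext => [u v|] /=; rewrite ?addrK ?gcompVr ?addrN. Qed.

Definition wreath : groupoid :=
  @Groupoid unit (fun _ _ => ((Q -> loops G) * Q)%type) (fun=> wreath_one)
    (fun _ _ _ => wreath_mul) (fun _ _ => wreath_inv)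
    (fun _ _ _ _ => wreath_mulA) (fun _ _ => wreath_mul1l)
    (fun _ _ => wreath_mul1r) (fun _ _ => wreath_mulVl)
    (fun _ _ => wreath_mulVr).

End Wreath.

Lemma nerve_wreath_reduced (G : groupoid) (Q : zmodType)
    (v w : nerve (wreath G Q) 0) : v = w.
Proof.
have e0 i : v i = w i by case: (v i); case: (w i).
apply: (@functor_ext _ _ v w e0) => i j []; rewrite [i]ord1 [j]ord1.
by rewrite (fmap_id v ord0) (fmap_id w ord0) hcast_id.
Qed.

Section Indicator.
Local Open Scope ring_scope.
Variable T : Type.
Implicit Types x y : T.

Definition indicator x : T -> int := fun z => `[< z = x >]%:R.

Lemma indicator_inj : injective indicator.
Proof.
move=> x y /(congr1 (fun f => f x)); rewrite /indicator asboolT //.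
by case: asboolP.
Qed.

(** A nonzero difference of two indicators determines both of them: it is 1
    exactly at [y] and -1 exactly at [x].  The values 1 and -1 differ, as they
    would not modulo 2. *)
Lemma indicatorB_inj x y x' y' : x <> x' ->
  indicator y - indicator x = indicator y' - indicator x' -> y = x /\ y' = x'.
Proof.
move=> xx' E.
have Ex : `[< x = y >]%:R - `[< x = x >]%:R =
          `[< x = y' >]%:R - `[< x = x' >]%:R :> int.
  exact: (congr1 (fun f : T -> int => f x) E).
have yx : y = x.
  move: Ex; rewrite (asboolT (erefl x)) (asboolF xx').
  by case: asboolP => [->//|_]; case: asboolP.
split=> //; apply: indicator_inj; apply/eqP.
by rewrite -subr_eq0 -E yx subrr.
Qed.

End Indicator.

Section Spread.
Local Open Scope ring_scope.
Variable G : groupoid.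
Implicit Types x y z : G.
Let Q : zmodType := G -> int.

(** This is the product of the translation by [- indicator x], of
    [based_loop g] placed at coordinate 0, and of the translation by
    [indicator y]; hence it is functorial in [g]. *)
Definition spread x y (g : ghom x y) : (Q -> loops G) * Q :=
  (fun u v => if u == indicator x then based_loop g v else gid v,
   indicator y - indicator x).

Lemma spread_id x : spread (gid x) = @wreath_one G Q.
Proof.
apply: wreath_ext => [u v|] /=; last by rewrite subrr.
by case: eqP => // _; rewrite based_loop_id.
Qed.

Lemma spread_comp x y z (g : ghom x y) (h : ghom y z) :
  spread (gcomp g h) = wreath_mul (spread g) (spread h).
Proof.
apply: wreath_ext => [u v|] /=; last first.
  by rewrite [RHS]addrC addrA subrK.
have -> : (u + (indicator y - indicator x) == indicator y) =
          (u == indicator x).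
  rewrite -[LHS]subr_eq0 -[RHS]subr_eq0.
  by rewrite addrCA [X in X == 0]addrC addKr.
case: eqP => _; first by rewrite based_loop_comp.
by rewrite gcomp1l.
Qed.

Definition spread_functor : functor G (wreath G Q) :=
  @Functor G (wreath G Q) (fun=> tt) spread spread_id (@spread_comp).

Lemma spread_faithful x y x' y' (g : ghom x y) (g' : ghom x' y')
    (ex : x = x') (ey : y = y') : spread g = spread g' -> hcast ex ey g = g'.
Proof.
case: x' / ex g'; case: y' / ey => g' E; apply: based_loop_inj => v.
have := congr1 (fun a : (Q -> loops G) * Q => a.1 (indicator x) v) E.
by rewrite /= eqxx.
Qed.

(** Nontrivial loops at distinct objects occupy distinct coordinates. *)
Lemma spread_separates x y x' y' (g : ghom x y) (g' : ghom x' y') :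
  x <> x' -> spread g = spread g' -> y = x /\ spread g = @wreath_one G Q.
Proof.
move=> xx' E.
have [yx yx'] := indicatorB_inj xx' (congr1 snd E).
split=> //; apply: wreath_ext => [u v|] /=; last by rewrite yx subrr.
case: (u == indicator x) => //.
have := congr1 (fun a : (Q -> loops G) * Q => a.1 (indicator x) v) E.
by rewrite /= eqxx; case: eqP => // e; case: xx'; exact: indicator_inj.
Qed.

Lemma spread_trivial_degenerate n (F : nerve G n) :
  (forall i j : 'I_n.+1, (F : functor _ _) j = (F : functor _ _) i /\
     spread (@fmap _ _ (F : functor _ _) i j tt) = @wreath_one G Q) ->
  totally_degenerate F.
Proof.
move=> F1; exists (vertex ord0 F).
have e0 i : (F : functor _ _) i = (degen n (vertex ord0 F) : functor _ _) i.
  by have [] := F1 ord0 i.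
apply: (@functor_ext _ _ F (degen n (vertex ord0 F)) e0) => i j [].
apply: spread_faithful; have [_ ->] := F1 i j.
by have [_ /= ->] := F1 ord0 ord0.
Qed.

(** If the initial objects agree, the Q-parts make all the objects agree, and
    faithfulness does the rest.  If they differ, the arrows from the initial
    object show that each simplex is constant on objects, with distinct values
    for the two; their loops then have the same image, so are identities. *)
Lemma spread_nerve_inj n (F F' : nerve G n) :
  nerve_map spread_functor n F = nerve_map spread_functor n F' ->
  red_rel F F'.
Proof.
move=> E.
have EFF i j : spread (@fmap _ _ (F : functor _ _) i j tt) =
               spread (@fmap _ _ (F' : functor _ _) i j tt).
  have := @fmap_eq _ _ (nerve_map spread_functor n F)
    (nerve_map spread_functor n F') i j tt erefl erefl E.
  exact.
have [F0|F0] := pselect ((F : functor _ _) ord0 = (F' : functor _ _) ord0).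
  left.
  have e0 i : (F : functor _ _) i = (F' : functor _ _) i.
    apply: indicator_inj; have := congr1 snd (EFF ord0 i).
    by rewrite /= F0 => /addIr.
  by apply: (@functor_ext _ _ F F' e0) => i j []; exact: spread_faithful.
have Fi i : (F : functor _ _) i <> (F' : functor _ _) i.
  have [e _] := spread_separates F0 (EFF ord0 i).
  have [e' _] := spread_separates (nesym F0) (esym (EFF ord0 i)).
  by rewrite e e'.
right; split; apply: spread_trivial_degenerate => i j.
  exact: spread_separates (Fi i) (EFF i j).
exact: spread_separates (nesym (Fi i)) (esym (EFF i j)).
Qed.

End Spread.

(** * Embeddability of the reduction *)

Theorem theorem26 (X : symSet) (hX : partial_groupoid X) :
  embeddable X <-> embeddable (reduction X).
Proof.
split=> /sym_monoP unit_inj.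
  pose f := sym_comp (nerve_map (spread_functor (tau X))) (tau_unit X).
  apply: (embeddable_of_inj (f := red_lift f (@nerve_wreath_reduced _ _))).
  apply: red_lift_inj => n x y fxy.
  exact: red_rel_inj unit_inj (spread_nerve_inj fxy).
apply/sym_monoP => n x y xy.
have /unit_inj /(clsP (@red_rel_equiv X n)) [//|[dx dy]] :=
  tau_unit_finest (sym_comp (tau_unit (reduction X)) (red_proj X)) xy.
rewrite (totally_degenerateE dx) (totally_degenerateE dy); congr degen.
exact: (congr1 (fun F : nerve (tau X) n => (F : functor _ _) ord0) xy).
Qed.
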